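(* Fix $\mu_0\in\mathcal P(X_0)$ and $\mu_K\in\mathcal P(X_K)$ and let $$M:=\inf\Big\{\int_\Omega c\,d\pi \ :\ \mu_k\in\mathcal P(\widehat X_k)\ (1\le k\le K-1),\ \pi\in\Pi(\mu_0,\mu_1,\dots,\mu_{K-1},\mu_K)\Big\}.$$ If $M<\infty$ and $c$ is coercive, then this optimization problem admits a minimizer: there exist $\mu_k^*\in\mathcal P(\widehat X_k)$, $1\le k\le K-1$, and a coupling $\pi^*\in\Pi(\mu_0,\mu_1^*,\dots,\mu_{K-1}^*,\mu_K)$ with $\int_\Omega c\,d\pi^*=M$.
   Context: Let $K\ge 1$ and let $X_0,\dots,X_K$ be Polish spaces. For $1\le k\le K-1$ let $\widehat X_k:=X_k\cup\{\partial_k\}$, where $\partial_k\notin X_k$ is added as an isolated point (so $\widehat X_k$ is Polish); put $\widehat X_0:=X_0$, $\widehat X_K:=X_K$. $\mathcal P(\cdot)$ denotes the set of Borel probability measures. The path space is $\Omega:=\prod_{k=0}^K\widehat X_k$ with the product topology, and $T_k:\Omega\to\widehat X_k$ is the $k$-th projection. $\Pi(\mu_0,\dots,\mu_K)$ is the set of $\pi\in\mathcal P(\Omega)$ with $(T_k)_\#\pi=\mu_k$ for $k=0,\dots,K$. For $\omega=(\widehat x_0,\dots,\widehat x_K)\in\Omega$, the active indices are $0=k_0<k_1<\dots<k_{n-1}=K$, where $\{k_1,\dots,k_{n-2}\}=\{1\le k\le K-1:\widehat x_k\in X_k\}$. Given lower semicontinuous functions $c_{i,j}:X_i\times X_j\to[0,+\infty]$,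 $0\le i<j\le K$, the path cost is $$c(\omega):=\sum_{l=0}^{n-2}c_{k_l,k_{l+1}}(\widehat x_{k_l},\widehat x_{k_{l+1}}).$$ A minimizing sequence is a sequence $(\pi_n)$ in $\mathcal P(\Omega)$ with $(T_0)_\#\pi_n=\mu_0$, $(T_K)_\#\pi_n=\mu_K$ and $\int_\Omega c\,d\pi_n\to M$. The cost $c$ is coercive if there is a measurable function $\Phi:\Omega\to[0,+\infty]$ such that (1) for every $R>0$ the set $\{\omega\in\Omega:\Phi(\omega)\le R\}$ is compact; and (2) there exists a minimizing sequence $(\pi_n)$ with $\sup_n\int_\Omega\Phi\,d\pi_n<\infty$. *)

(* Defs.v *)
From HB Require Import structures.
From mathcomp Require Import all_boot all_order all_algebra.
From mathcomp Require Import all_classical all_reals all_analysis.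
From mathcomp Require Import measurable_realfun.
Set Implicit Arguments.
Unset Strict Implicit.
Unset Printing Implicit Defensive.
Import Order.TTheory GRing.Theory Num.Theory.
Local Open Scope classical_set_scope.
Local Open Scope ring_scope.
Local Open Scope ereal_scope.

Definition complete_metric_for (R : realType) (T : topologicalType)
    (d : T -> T -> R) : Prop :=
  [/\ forall x y, (0 <= d x y)%R,
      forall x y, d x y = 0%R <-> x = y,
      forall x y, d x y = d y x &
      forall x y z, (d x z <= d x y + d y z)%R] /\
  (forall (x : T) (A : set T),
     nbhs x A <-> exists2 e : R, (0 < e)%R & [set y | (d x y < e)%R] `<=` A) /\
  (forall u : nat -> T,
     (forall e : R, (0 < e)%R ->
        exists N : nat, forall m n : nat, (N <= m)%N -> (N <= n)%N ->
          (d (u m) (u n) < e)%R) ->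
     exists l : T, u @ \oo --> l).

Definition polish (R : realType) (T : topologicalType) : Prop :=
  (exists2 D : set T, countable D & dense D) /\
  exists d : T -> T -> R, complete_metric_for d.

(* [adjoin_pt T] is the topological disjoint union of T and an isolated point
   [None]. *)
Definition adjoin_pt (T : Type) : Type := option T.

HB.instance Definition _ (T : choiceType) := Choice.on (adjoin_pt T).
HB.instance Definition _ (T : choiceType) := isPointed.Build (adjoin_pt T) None.

Section adjoin_pt_topology.
Context (T : topologicalType).

Let op (U : set (adjoin_pt T)) : Prop := open ((Some : T -> adjoin_pt T) @^-1` U).

Let opT : op setT.
Proof. by rewrite /op preimage_setT; exact: openT. Qed.

Let opI : setI_closed op.
Proof. by move=> A B oA oB; rewrite /op preimage_setI; exact: openI. Qed.

Let op_bigU (I : Type) (f : I -> set (adjoin_pt T)) :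
  (forall i, op (f i)) -> op (\bigcup_i f i).
Proof.
by move=> of_; rewrite /op preimage_bigcup; apply: bigcup_open => i _; exact: of_.
Qed.

HB.instance Definition _ :=
  isOpenTopological.Build (adjoin_pt T) opT opI op_bigU.

Lemma open_adjoin_ptE (U : set (adjoin_pt T)) :
  open U = open ((Some : T -> adjoin_pt T) @^-1` U).
Proof. by []. Qed.

Lemma open_adjoin_pt_None : open [set None : adjoin_pt T].
Proof.
rewrite open_adjoin_ptE (_ : _ @^-1` _ = set0); first exact: open0.
by apply/seteqP; split.
Qed.

End adjoin_pt_topology.

Definition inner (K : nat) (k : 'I_K.+1) : bool := (0 < k < K)%N.

(* [spaceType (inner k)] is the type of the spaces allowed at index k, and [hat]
   adjoins an isolated point to them exactly when k is an inner index.
   Measurable types are pointed in the library.  The inner spaces may be empty,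
   since their augmentations contain [None]; the two extreme ones are nonempty
   as soon as they carry a probability, and are required to be pointed. *)
Definition spaceType (b : bool) : Type :=
  if b then topologicalType else ptopologicalType.

Definition space (b : bool) : spaceType b -> topologicalType :=
  match b with true => fun T => T | false => fun T => T end.

Coercion space : spaceType >-> topologicalType.

Definition hat (b : bool) : spaceType b -> ptopologicalType :=
  match b with true => fun T => adjoin_pt T | false => fun T => T end.

Definition visited (b : bool) : forall T : spaceType b, hat T -> option T :=
  match b with true => fun T x => x | false => fun T x => Some x end.

Definition path_space (K : nat) (X : forall k : 'I_K.+1, spaceType (inner k)) : Type :=
  prod_topology (fun k : 'I_K.+1 => hat (X k)).

Definition base_path (K : nat) (X : forall k : 'I_K.+1, spaceType (inner k)) :
    path_space X := fun k => @point (hat (X k)).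

HB.instance Definition _ (K : nat) (X : forall k : 'I_K.+1, spaceType (inner k)) :=
  Topological.copy (path_space X) (prod_topology (fun k : 'I_K.+1 => hat (X k))).
HB.instance Definition _ (K : nat) (X : forall k : 'I_K.+1, spaceType (inner k)) :=
  isPointed.Build (path_space X) (base_path X).

Definition proj_path (K : nat) (X : forall k : 'I_K.+1, spaceType (inner k))
    (k : 'I_K.+1) (w : path_space X) : hat (X k) := w k.

Notation borel T := (g_sigma_algebraType (@open T)).
Notation borel_prob R T := (probability (borel T) R).

Definition active (K : nat) (X : forall k : 'I_K.+1, spaceType (inner k))
    (w : path_space X) : seq 'I_K.+1 :=
  [seq k <- enum 'I_K.+1 | isSome (visited (proj_path k w))].

(* The value 0 is irrelevant: [path_cost] only uses active indices. *)
Definition step_cost (R : realType) (K : nat)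
    (X : forall k : 'I_K.+1, spaceType (inner k))
    (c : forall i j : 'I_K.+1, X i * X j -> \bar R)
    (w : path_space X) (i j : 'I_K.+1) : \bar R :=
  match visited (proj_path i w), visited (proj_path j w) with
  | Some x, Some y => c i j (x, y)
  | _, _ => 0
  end.

Definition path_cost (R : realType) (K : nat)
    (X : forall k : 'I_K.+1, spaceType (inner k))
    (c : forall i j : 'I_K.+1, X i * X j -> \bar R)
    (w : path_space X) : \bar R :=
  let k := nth ord0 (active w) in
  \sum_(0 <= l < (size (active w)).-1) step_cost c w (k l) (k l.+1).

Definition has_marginal (R : realType) (K : nat)
    (X : forall k : 'I_K.+1, spaceType (inner k))
    (pi : borel_prob R (path_space X)) (k : 'I_K.+1)
    (mu : borel_prob R (hat (X k))) : Prop :=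
  forall A : set (borel (hat (X k))), measurable A ->
    pushforward pi (@proj_path K X k : borel (path_space X) -> borel (hat (X k))) A
    = mu A.

Definition couplings (R : realType) (K : nat)
    (X : forall k : 'I_K.+1, spaceType (inner k))
    (mu : forall k : 'I_K.+1, borel_prob R (hat (X k))) :
    set (borel_prob R (path_space X)) :=
  [set pi | forall k : 'I_K.+1, has_marginal pi (mu k)].

Definition total_cost (R : realType) (K : nat)
    (X : forall k : 'I_K.+1, spaceType (inner k))
    (c : forall i j : 'I_K.+1, X i * X j -> \bar R)
    (pi : borel_prob R (path_space X)) : \bar R :=
  \int[pi]_(w in [set: borel (path_space X)]) path_cost c w.

Definition optimal_value (R : realType) (K : nat)
    (X : forall k : 'I_K.+1, spaceType (inner k))
    (c : forall i j : 'I_K.+1, X i * X j -> \bar R)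
    (mu0 : borel_prob R (hat (X ord0)))
    (muK : borel_prob R (hat (X ord_max))) : \bar R :=
  ereal_inf [set r | exists mu : forall k : 'I_K.+1, borel_prob R (hat (X k)),
    [/\ mu ord0 = mu0, mu ord_max = muK &
        exists2 pi, couplings mu pi & r = total_cost c pi]].

Definition minimizing_sequence (R : realType) (K : nat)
    (X : forall k : 'I_K.+1, spaceType (inner k))
    (c : forall i j : 'I_K.+1, X i * X j -> \bar R)
    (mu0 : borel_prob R (hat (X ord0)))
    (muK : borel_prob R (hat (X ord_max)))
    (pi : nat -> borel_prob R (path_space X)) : Prop :=
  [/\ forall n, has_marginal (pi n) mu0,
      forall n, has_marginal (pi n) muK &
      (fun n => total_cost c (pi n)) @ \oo --> optimal_value c mu0 muK].

Definition coercive (R : realType) (K : nat)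
    (X : forall k : 'I_K.+1, spaceType (inner k))
    (c : forall i j : 'I_K.+1, X i * X j -> \bar R)
    (mu0 : borel_prob R (hat (X ord0)))
    (muK : borel_prob R (hat (X ord_max))) : Prop :=
  exists Phi : borel (path_space X) -> \bar R,
    [/\ measurable_fun [set: borel (path_space X)] Phi,
        forall w, 0 <= Phi w,
        forall r : R, (0 < r)%R ->
          compact ([set w | Phi w <= r%:E] : set (path_space X)) &
        exists2 pi : nat -> borel_prob R (path_space X),
          minimizing_sequence c mu0 muK pi &
          ereal_sup (range (fun n => \int[pi n]_w Phi w)) < +oo].

(* Main.v *)
(* Coercivity and Markov's inequality make the minimizing sequence (P n) tight.
   Instead of extracting a weakly convergent subsequence, fix an ultrafilter U
   on nat finer than the filter of neighbourhoods of infinity and let lam A be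
   the U-limit of P n A, a finitely additive content.  The inner regularization
   beta G = sup {lam H | H compact, H included in G} on open sets generates an
   outer measure for which Borel sets are measurable; by tightness it has total
   mass 1, so it is a probability Q, with Q G <= lam G for G open.  Only the
   Hausdorff property is needed for this.
   The marginals at 0 and K are U-limits of constant sequences, so those of Q
   are below mu0 and muK on open sets; both being probabilities on a metric
   space, where open sets are F_sigma, they are equal.  Finally the cost is
   lower semicontinuous, as the set of active indices is locally constant, so
   its superlevel sets are open and its Q-integral is at most the U-limit of
   its P n-integrals, that is the optimal value. *)
Require Import Defs.
From HB Require Import structures.
From mathcomp Require Import all_boot all_order all_algebra.
From mathcomp Require Import all_classical all_reals all_analysis.
From mathcomp Require Import measurable_realfun.
From mathcomp Require Import lra.
Import Order.TTheory GRing.Theory Num.Theory.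
Import numFieldNormedType.Exports.
Local Open Scope classical_set_scope.
Local Open Scope ring_scope.
Local Open Scope ereal_scope.

(** * Splitting compact sets *)

(** Compactness is used twice in its near-covering form, over filters of small neighbourhoods.
    Covering A shows that each point of B has a neighbourhood whose closure misses A; covering B
    then gives one neighbourhood of A whose closure misses B. *)
Lemma compact_sep (T : topologicalType) (A B : set T) :
  hausdorff_space T -> compact A -> compact B -> A `&` B = set0 ->
  exists V : set T, [/\ open V, A `<=` V & B `&` closure V = set0].
Proof.
move=> hT cA cB AB0.
have [->|/set0P A0] := eqVneq A set0.
  by exists set0; split => //; [exact: open0|rewrite closure0 setI0].
have sepP y : B y -> exists2 U, nbhs y U & A `&` closure U = set0.
  move=> By; have /compact_near_coveringP := cA.
  move=> /(_ _ (powerset_filter_from (nbhs y)) (fun U x => ~ closure U x)).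
  case=> [x Ax|F [FN _ [V FV]] H]; last first.
    exists V; first exact: FN.
    apply/seteqP; split => // x [Ax]; exact: (H V FV).
  have xy : x != y.
    apply/eqP => xy; suff : (A `&` B) x by rewrite AB0.
    by split => //; rewrite xy.
  have := hT; rewrite open_hausdorff => /(_ x y xy)[[P Q]] /=.
  rewrite !inE => -[Px Qy] [oP oQ PQ0].
  near=> x' U => /= clU.
  have Px' : P x' by near: x'; apply: open_nbhs_nbhs.
  have UQ : U `<=` Q by near: U; apply: small_set_sub; apply: open_nbhs_nbhs.
  have [z [Uz Pz]] := clU P (open_nbhs_nbhs (conj oP Px')).
  by suff : (P `&` Q) z by [rewrite PQ0]; split; last exact: UQ.
have := set_nbhs_pfilter A0 => PF.
have /compact_near_coveringP := cB.
move=> /(_ _ (powerset_filter_from (set_nbhs A)) (fun U x => ~ closure U x)).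
case=> [x Bx|F [FN Fdown [V FV]] H].
  have [U nU AU0] := sepP x Bx.
  near=> x' V => /= clV.
  have Ux' : nbhs x' U by near: x'; exact: nbhs_interior.
  have VU : V `<=` ~` closure U.
    near: V; apply: small_set_sub => z Az; apply: open_nbhs_nbhs.
    split; first exact/closed_openC/closed_closure.
    by move=> Uz; suff : (A `&` closure U) z by rewrite AU0.
  have [z [Vz Uz]] := clV U Ux'.
  exact/(VU _ Vz)/subset_closure.
have /set_nbhsP[W [oW AW WV]] := FN _ FV.
exists W; split => //; apply/seteqP; split => // x [Bx cWx].
by apply: (H V FV x Bx); exact: closureS cWx.
Unshelve. all: by end_near.
Qed.

(** The compact sets H \ A and H \ B are disjoint. An open V around the first, with closure off the
    second, cuts H into H \ V and the trace of the closure of V. *)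
Lemma compact_split (T : topologicalType) (H A B : set T) :
  hausdorff_space T -> compact H -> open A -> open B -> H `<=` A `|` B ->
  exists HA HB : set T, [/\ compact HA, compact HB, HA `<=` A, HB `<=` B &
    H = HA `|` HB].
Proof.
move=> hT cH oA oB HAB.
have AB0 : (H `\` A) `&` (H `\` B) = set0.
  by apply/seteqP; split => // x [[Hx nA] [_ nB]]; case: (HAB x Hx).
have [V [oV HAV HBV]] := @compact_sep T _ _ hT (compact_closedI cH (open_closedC oA))
  (compact_closedI cH (open_closedC oB)) AB0.
exists (H `\` V), (H `&` closure V); split.
- exact/compact_closedI/open_closedC.
- exact/compact_closedI/closed_closure.
- by move=> x [Hx nV]; apply: contrapT => nA; apply/nV/HAV.
- move=> x [Hx cV]; apply: contrapT => nB.
  by suff : ((H `\` B) `&` closure V) x by rewrite HBV.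
- apply/seteqP; split => x; last by case=> -[].
  by move=> Hx; have [Vx|nV] := pselect (V x); [right|left]; split => //;
    exact: subset_closure.
Qed.

(** * The measure generated by a content on compact sets *)

Definition inner_content (R : realType) (T : topologicalType) (lam : set T -> R)
    (G : set T) : \bar R :=
  ereal_sup [set (lam H)%:E | H in [set H | compact H /\ H `<=` G]].

Definition outer_content (R : realType) (T : topologicalType) (lam : set T -> R)
    (A : set T) : \bar R :=
  ereal_inf [set inner_content R T lam G | G in [set G | open G /\ A `<=` G]].

Section content.
Context (R : realType) (T : ptopologicalType) (lam : set T -> R).
Hypothesis hT : hausdorff_space T.
Hypothesis lam0 : lam set0 = 0%R.
Hypothesis lam_le1 : forall H, compact H -> (lam H <= 1)%R.
Hypothesis lamU : forall H H', compact H -> compact H' ->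
  (lam (H `|` H') <= lam H + lam H')%R.
Hypothesis lamUd : forall H H', compact H -> compact H' -> H `&` H' = set0 ->
  lam (H `|` H') = (lam H + lam H')%R.

Local Notation beta := (inner_content R T lam).
Local Notation gamma := (outer_content R T lam).

Lemma inner_content_ge0 G : 0 <= beta G.
Proof.
apply: ereal_sup_ubound; exists set0; last by rewrite lam0.
by split => //; exact: compact0.
Qed.

Lemma inner_content_le1 G : beta G <= 1.
Proof. by apply: ge_ereal_sup => _ [H [cH _] <-]; rewrite lee_fin lam_le1. Qed.

Lemma inner_content_fin G : beta G \is a fin_num.
Proof.
rewrite ge0_fin_numE ?inner_content_ge0//.
by rewrite (le_lt_trans (inner_content_le1 G))// ltry.
Qed.

Lemma le_inner_content G G' : G `<=` G' -> beta G <= beta G'.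
Proof.
move=> GG'; apply: ge_ereal_sup => _ [H [cH HG] <-].
by apply: ereal_sup_ubound; exists H => //; split => //; exact: subset_trans GG'.
Qed.

Lemma content_le_inner H G : compact H -> H `<=` G -> (lam H)%:E <= beta G.
Proof. by move=> cH HG; apply: ereal_sup_ubound; exists H. Qed.

Lemma outer_content_open G : open G -> gamma G = beta G.
Proof.
move=> oG; apply/eqP; rewrite eq_le; apply/andP; split.
  by apply: ereal_inf_lbound; exists G => //; split.
by apply: le_ereal_inf_tmp => _ [G' [_ GG'] <-]; exact: le_inner_content.
Qed.

Lemma outer_content_ge0 A : 0 <= gamma A.
Proof. by apply: le_ereal_inf_tmp => _ [G _ <-]; exact: inner_content_ge0. Qed.

Lemma outer_content0 : gamma set0 = 0.
Proof.
rewrite outer_content_open; last exact: open0.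
apply/eqP; rewrite eq_le inner_content_ge0 andbT.
by apply: ge_ereal_sup => _ [H [_ H0] <-]; move: H0; rewrite subset0 => ->; rewrite lam0.
Qed.

Lemma le_outer_content : {homo gamma : A B / A `<=` B >-> A <= B}.
Proof.
move=> A B AB; apply: le_ereal_inf_tmp => _ [G [oG BG] <-].
by apply: ereal_inf_lbound; exists G => //; split => //; exact: subset_trans BG.
Qed.

Lemma outer_content_fin A : gamma A \is a fin_num.
Proof.
rewrite ge0_fin_numE ?outer_content_ge0//.
rewrite (le_lt_trans (le_outer_content _ _ (@subsetT _ A)))//.
rewrite outer_content_open; last exact: openT.
by rewrite (le_lt_trans (inner_content_le1 _))// ltry.
Qed.

(** By induction, [compact_split] detaches from H a compact piece lying in the last open set. *)
Lemma content_bigcup_le (G : nat -> set T) (n : nat) : (forall i, open (G i)) ->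
  forall H, compact H -> H `<=` \bigcup_(i < n) G i ->
  (lam H)%:E <= \sum_(0 <= i < n) beta (G i).
Proof.
move=> oG; elim: n => [|n IH] H cH.
  by rewrite bigcup_mkord big_ord0 big_geq// subset0 => ->; rewrite lam0.
rewrite bigcup_mkord big_ord_recr/= => HG.
have oU : open (\big[setU/set0]_(i < n) G i) by rewrite -bigcup_mkord; exact: bigcup_open.
have [H1 [H2 [cH1 cH2 H1G H2G ->]]] := compact_split _ _ _ _ hT cH oU (oG n) HG.
rewrite big_nat_recr//=.
apply: (@le_trans _ _ ((lam H1)%:E + (lam H2)%:E)).
  by rewrite -EFinD lee_fin lamU.
by apply: leeD; [apply: IH => //; rewrite bigcup_mkord|exact: content_le_inner].
Qed.

(** A compact subset of the union already lies in a finite subunion, which reduces the claim to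
    [content_bigcup_le]. *)
Lemma inner_content_bigcup (G : nat -> set T) : (forall i, open (G i)) ->
  beta (\bigcup_i G i) <= \sum_(i <oo) beta (G i).
Proof.
move=> oG; apply: ge_ereal_sup => _ [H [cH HG] <-].
have [n Hn] : exists n, H `<=` \bigcup_(i < n) G i.
  have /compact_near_coveringP := cH.
  move=> /(_ _ \oo (fun n x => (\bigcup_(i < n) G i) x)).
  case=> [x /HG[i _ Gix]|n _ /(_ n (leqnn n))]; last by exists n.
  exists (G i, [set n | (i < n)%N]) => /=.
    by split; [exact: open_nbhs_nbhs|exact: nbhs_infty_gt].
  by move=> [x' n] [/= Gx' ni]; exists i.
apply: (le_trans (content_bigcup_le _ _ oG _ cH Hn)).
by apply: nneseries_lim_ge => i _ _; exact: inner_content_ge0.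
Qed.

Lemma outer_content_sigma_subadditive : sigma_subadditive gamma.
Proof.
move=> F; apply/lee_addgt0Pr => e e0.
apply: (le_trans _ (epsilon_trick xpredT _ (ltW e0))); last first.
  by move=> n; exact: outer_content_ge0.
have P n : exists G, [/\ open G, F n `<=` G &
    beta G <= gamma (F n) + (e / (2 ^ n.+1)%:R)%:E].
  have e2 : (0 < e / (2 ^ n.+1)%:R)%R by rewrite divr_gt0// ltr0n expn_gt0.
  have [_ [G [oG FG] <-] /ltW le] :=
    lb_ereal_inf_adherent e2 (outer_content_fin (F n)).
  by exists G.
have [G /all_and3[oG FG GF]] := choice P.
apply: (@le_trans _ _ (\sum_(i <oo) beta (G i))); last first.
  by apply: lee_nneseries => // i _ _; exact: inner_content_ge0.
apply: (le_trans _ (inner_content_bigcup _ oG)).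
rewrite -outer_content_open; last by apply: bigcup_open.
apply: le_outer_content => x [i _ Fi]; exists i => //; exact: FG.
Qed.

HB.instance Definition _ := isOuterMeasure.Build R T gamma outer_content0
  outer_content_ge0 le_outer_content outer_content_sigma_subadditive.

Lemma closed_caratheodory F : closed F -> caratheodory_measurable gamma F.
Proof.
move=> cF; apply: le_caratheodory_measurable => X.
apply: le_ereal_inf_tmp => _ [G [oG XG] <-].
have oGF : open (G `&` ~` F) by apply: openI => //; exact: closed_openC.
apply/lee_addgt0Pr => e e0; have e2 : (0 < e / 2)%R by rewrite divr_gt0.
(* A nearly optimal compact H1 in G \ F is disjoint from a nearly optimal compact
   H2 in G \ H1, an open set containing F intersected with G. *)
have [_ [H1 [cH1 H1G] <-] lt1] :=
  ub_ereal_sup_adherent e2 (inner_content_fin (G `&` ~` F)).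
have oGH : open (G `&` ~` H1).
  by apply: openI => //; apply: closed_openC; exact: compact_closed.
have [_ [H2 [cH2 H2G] <-] lt2] :=
  ub_ereal_sup_adherent e2 (inner_content_fin (G `&` ~` H1)).
have H12 : H1 `&` H2 = set0 by apply/seteqP; split => // x [h1 /H2G[]].
apply: (@le_trans _ _ (beta (G `&` ~` H1) + beta (G `&` ~` F))).
  apply: leeD.
    rewrite -outer_content_open//; apply: le_outer_content => x [/XG Gx Fx].
    by split => // /H1G[].
  rewrite -outer_content_open//; apply: le_outer_content => x [/XG Gx Fx].
  by split.
have H12G : H1 `|` H2 `<=` G by move=> x [/H1G[]|/H2G[]].
have := content_le_inner (H1 `|` H2) G (@compactU _ _ _ cH1 cH2) H12G.
rewrite lamUd// => le12.
move: lt1 lt2 le12; rewrite -!/(beta _).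
move: (inner_content_fin (G `&` ~` F)) (inner_content_fin (G `&` ~` H1)).
move: (inner_content_fin G).
move=> /fineK <- /fineK <- /fineK <-.
rewrite -!EFinN -!EFinD !lte_fin !lee_fin; lra.
Qed.

(** A copy of [gamma] typed over the Borel sigma-algebra, so that it can carry a measure structure
    there. *)
Let m : set (borel T) -> \bar R := gamma.

Lemma borel_caratheodory (A : set (borel T)) : measurable A ->
  caratheodory_measurable gamma A.
Proof.
move=> mA.
have sC : sigma_algebra [set: T] (caratheodory_measurable gamma).
  split.
  - exact: caratheodory_measurable_set0.
  - by move=> B mB; rewrite setTD; exact: caratheodory_measurable_setC.
  - exact: caratheodory_measurable_bigcup.
have oC : @open T `<=` caratheodory_measurable gamma.
  move=> B oB; rewrite -(setCK B); apply: caratheodory_measurable_setC.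
  exact/closed_caratheodory/open_closedC.
by apply: (@smallest_sub _ _ _ _ sC oC A); exact: mA.
Qed.

Let m_sigma_additive : semi_sigma_additive m.
Proof.
move=> A mA tA mU; apply: (@caratheodory_measure_sigma_additive R T gamma) => //.
- by move=> i; exact: borel_caratheodory.
- exact: borel_caratheodory.
Qed.

HB.instance Definition _ := isMeasure.Build _ _ _ m
  outer_content0 outer_content_ge0 m_sigma_additive.

Lemma content_measure : exists mu : {measure set (borel T) -> \bar R},
  forall G : set T, open G -> mu G = beta G.
Proof. by exists m => G oG; exact: outer_content_open. Qed.

End content.

(** * Ultralimits of tight sequences of probabilities *)

(** The image ultrafilter contains a compact segment, hence has a cluster point, and an ultrafilter
    converges to each of its cluster points. *)
Lemma ultra_bounded_cvg (R : realType) (I : Type) (U : set_system I)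
    (x : I -> R) (a b : R) : UltraFilter U -> (forall i, x i \in `[a, b]) ->
  x @ U --> lim (x @ U).
Proof.
move=> UU xab; apply/cvg_ex.
have xU : (x @ U) [set` `[a, b]] by apply: nearW => i; exact: xab.
have [p [_ px]] := @segment_compact R a b _ (fmap_proper_filter x _) xU.
exists p => V pV /=.
have [//|nV] := in_ultra_setVsetC (x @^-1` V) UU.
have [y [/= + Vy]] := px (~` V) V nV pV.
by move=> /(_ Vy).
Qed.

Section measure_prob.
Context d (T : measurableType d) (R : realType).
Context (mu : {measure set T -> \bar R}) (mu1 : mu setT = 1).

Let m : set T -> \bar R := mu.
HB.instance Definition _ := Measure.on m.
HB.instance Definition _ := Measure_isProbability.Build _ _ _ m mu1.

Definition measure_prob : probability T R := m.
End measure_prob.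

Lemma open_borel (T : ptopologicalType) (A : set T) : open A ->
  measurable (A : set (borel T)).
Proof. exact: sub_sigma_algebra. Qed.

Lemma closed_borel (T : ptopologicalType) (A : set T) : closed A ->
  measurable (A : set (borel T)).
Proof.
move=> cA; rewrite -(setCK A); apply: measurableC; apply: open_borel.
exact: closed_openC.
Qed.

Section prokhorov.
Context (R : realType) (T : ptopologicalType) (P : nat -> borel_prob R T).
Context (U : set_system nat) (UU : UltraFilter U).
Hypothesis hT : hausdorff_space T.
Hypothesis tightP : forall e : R, (0 < e)%R ->
  exists2 H : set T, compact H & forall n, (1 - e)%:E <= P n H.

(** Since [lim] is total, this is defined for every A; for Borel A it is a genuine limit by
    [ultra_content_cvg]. *)
Definition ultra_content (A : set T) : R := lim ((fun n => fine (P n A)) @ U).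
Local Notation lam := ultra_content.

Lemma compact_borel (H : set T) : compact H -> measurable (H : set (borel T)).
Proof. by move=> cH; apply: closed_borel; exact: compact_closed. Qed.

Lemma ultra_content_cvg (A : set (borel T)) : measurable A ->
  (fun n => fine (P n A)) @ U --> lam A.
Proof.
move=> mA; apply: (@ultra_bounded_cvg R nat U _ 0 1) => n.
rewrite in_itv/= fine_ge0//= -lee_fin fineK ?fin_num_measure//.
exact: probability_le1.
Qed.

Lemma ultra_content_le (A : set (borel T)) (r : R) : measurable A ->
  (forall n, P n A <= r%:E) -> (lam A <= r)%R.
Proof.
move=> mA Ar; apply: (limr_le (cvgP _ (ultra_content_cvg A mA))).
by near=> n; rewrite -lee_fin fineK ?fin_num_measure.
Unshelve. all: by end_near.
Qed.

Lemma ultra_content_ge (A : set (borel T)) (r : R) : measurable A ->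
  (forall n, r%:E <= P n A) -> (r <= lam A)%R.
Proof.
move=> mA Ar; apply: (limr_ge (cvgP _ (ultra_content_cvg A mA))).
by near=> n; rewrite -lee_fin fineK ?fin_num_measure.
Unshelve. all: by end_near.
Qed.

Lemma prokhorov_ultra : exists Q : borel_prob R T,
  forall G : set T, open G -> Q G <= (lam G)%:E.
Proof.
have UF : Filter U by exact: filter_filter.
have lamUd H H' : compact H -> compact H' -> H `&` H' = set0 ->
    lam (H `|` H') = (lam H + lam H')%R.
  move=> /compact_borel mH /compact_borel mH' HH'0.
  have cD := cvgD (FF := UF) (ultra_content_cvg H mH) (ultra_content_cvg H' mH').
  rewrite -(cvg_lim _ cD)//; congr (lim (_ @ U)); apply/funext => n /=.
  by rewrite measureU// fineD// fin_num_measure.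
have lamU H H' : compact H -> compact H' ->
    (lam (H `|` H') <= lam H + lam H')%R.
  move=> /compact_borel mH /compact_borel mH'.
  have mU := measurableU _ _ mH mH'.
  have cD := cvgD (FF := UF) (ultra_content_cvg H mH) (ultra_content_cvg H' mH').
  rewrite -(cvg_lim _ cD)//.
  apply: ler_lim; [exact: cvgP (ultra_content_cvg _ mU)|exact: cvgP cD|].
  near=> n; rewrite -lee_fin EFinD !fineK ?fin_num_measure//.
  exact: measureU2.
have lam0 : lam set0 = 0%R.
  (* Additivity on two empty sets gives x = x + x. *)
  have := lamUd _ _ compact0 compact0 (setI0 _); rewrite setU0; lra.
have lam1 H : compact H -> (lam H <= 1)%R.
  move=> /compact_borel mH; apply: ultra_content_le => // n.
  exact: probability_le1.
have [mu muE] := content_measure R T lam hT lam0 lam1 lamU lamUd.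
have mu1 : mu setT = 1.
  rewrite muE; last exact: openT.
  apply/eqP; rewrite eq_le inner_content_le1//=.
  (* No mass is lost: the bound 1 - e on a compact H is uniform in n, so it survives in the
     ultralimit and bounds [beta] of the whole space from below. *)
  apply/lee_addgt0Pr => e e0; have [H cH PH] := tightP e e0.
  rewrite -leeBlDr//; apply: le_trans (content_le_inner _ _ _ _ _ cH (@subsetT _ _)).
  rewrite -EFinB lee_fin; apply: ultra_content_ge => //; exact: compact_borel.
exists (measure_prob _ _ _ mu mu1) => G oG.
have -> : measure_prob _ _ _ mu mu1 G = mu G by [].
rewrite muE//; apply: ge_ereal_sup => _ [H [cH HG] <-]; rewrite lee_fin.
have mG : measurable (G : set (borel T)) by exact: sub_sigma_algebra.
have mH := compact_borel H cH.
apply: ler_lim; [exact: cvgP (ultra_content_cvg _ mH)|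
  exact: cvgP (ultra_content_cvg _ mG)|].
by near=> n; rewrite fine_le ?fin_num_measure// le_measure ?inE.
Unshelve. all: by end_near.
Qed.

End prokhorov.

(** * Integrals of lower semicontinuous functions *)

Section step_below.
Context (R : realType).

(* The left Riemann sum of the layer cake formula: h times the number of levels
   h, 2h, ..., nh lying strictly below y. *)
Definition step_below (n : nat) (h : R) (y : \bar R) : R :=
  (\sum_(0 <= i < n) (if ((i.+1%:R * h)%:E < y)%E then h else 0))%R.

Lemma step_below_ge0 n h y : (0 <= h)%R -> (0 <= step_below n h y)%R.
Proof. by move=> h0; apply: sumr_ge0 => i _; case: ifPn. Qed.

Lemma step_below_le n h r : (0 <= h)%R -> (0 <= r)%R ->
  (step_below n h r%:E <= r)%R.
Proof.
move=> h0 r0.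
(* The induction needs the second bound: when level (n+1)h is counted, the new sum is at most nh +
   h, which is below r. *)
suff : (step_below n h r%:E <= r)%R /\ (step_below n h r%:E <= n%:R * h)%R by case.
rewrite /step_below; elim: n => [|n [IH1 IH2]].
  by rewrite big_geq// mul0r.
rewrite big_nat_recr//= lte_fin.
have e : (n.+1%:R * h = n%:R * h + h :> R)%R by rewrite -natr1 mulrDl mul1r.
by move: IH1 IH2; case: ifPn; rewrite ?e => ? ? ?; split; lra.
Qed.

(** Either all n levels are counted, for a total of nh, or the first one missed is at least r and
    those before it add up to at least r - h. The real r under y lets the bound serve an infinite y
    as well. *)
Lemma step_below_ge n h r (y : \bar R) : (0 <= h)%R -> r%:E <= y ->
  (Num.min (r - h) (n%:R * h) <= step_below n h y)%R.
Proof.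
move=> h0 ry; rewrite /step_below; elim: n => [|n IH].
  by rewrite big_geq// mul0r ge_min lexx orbT.
rewrite big_nat_recr//=.
have e : (n.+1%:R * h = n%:R * h + h :> R)%R by rewrite -natr1 mulrDl mul1r.
move: IH; rewrite !ge_min; case: ifPn; rewrite e => yh /orP H; apply/orP.
  by case: H => H; [left|right]; lra.
left; case: H => H; first lra.
have : (r%:E <= (n%:R * h + h)%:E) by apply: (le_trans ry); rewrite leNgt.
rewrite lee_fin => ?; lra.
Qed.

(** With mesh 1/(m+1), the (m+1)^2 levels reach height m+1: the mesh vanishes while the range
    exhausts the half-line. *)
Lemma step_below_cvg (y : \bar R) : 0 <= y ->
  (fun m => (step_below (m.+1 ^ 2) m.+1%:R^-1 y)%:E) @ \oo --> y.
Proof.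
have nh m : ((m.+1 ^ 2)%:R * m.+1%:R^-1 = m.+1%:R :> R)%R.
  by rewrite natrX expr2 mulfK// pnatr_eq0.
have h0 m : (0 <= m.+1%:R^-1 :> R)%R by rewrite invr_ge0.
case: y => [r r0|_|//].
  apply: cvg_EFin; first by apply: nearW.
  rewrite lee_fin in r0.
  apply: (@squeeze_cvgr _ _ _ _ (fun m => r - m.+1%:R^-1)%R (fun=> r)).
  - have := nbhs_infty_ger r; apply: filterS => m rm /=.
    rewrite step_below_le// andbT.
    apply: le_trans (step_below_ge (m.+1 ^ 2) _ r r%:E (h0 m) (lexx _)).
    rewrite nh le_min lexx/=; have := h0 m; move: rm; rewrite -natr1 /=; lra.
  - rewrite -[X in _ --> X]subr0; apply: cvgB; first exact: cvg_cst.
    exact: cvg_harmonic.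
  - exact: cvg_cst.
apply/cvgeyPge => A; have := nbhs_infty_ger A; apply: filterS => m Am /=.
rewrite lee_fin.
(* As y is infinite, r is free; r = m+2 makes r - h at least m+1, since h <= 1. *)
apply: le_trans (step_below_ge (m.+1 ^ 2) _ (m.+1%:R + 1) +oo (h0 m) (leey _)).
rewrite nh le_min; apply/andP; split; last first.
  by rewrite (le_trans Am)// ler_nat.
have : (m.+1%:R^-1 <= 1 :> R)%R by rewrite invf_le1// ler1n.
move: Am; rewrite -natr1; lra.
Qed.

Lemma step_below_leE n h (y : \bar R) : (0 <= h)%R -> 0 <= y ->
  (step_below n h y)%:E <= y.
Proof.
by move=> h0; case: y => [r| |//] r0; rewrite ?leey// lee_fin step_below_le.
Qed.

(** Integrals of [step_below] thus involve only measures of strict superlevel sets. These are open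
    when f is lower semicontinuous, and open sets are where the limit measure is controlled. *)
Lemma step_below_indic (T : Type) (f : T -> \bar R) n h x :
  (step_below n h (f x))%:E =
  \sum_(0 <= i < n)
    (h%:E * (\1_[set x | ((i.+1%:R * h)%:E < f x)%E] x)%:E).
Proof.
rewrite -sumEFin; apply: eq_bigr => i _; rewrite indicE; case: ifPn => fx.
  by rewrite mem_set// mule1.
by rewrite memNset ?mule0//=; exact/negP.
Qed.

Lemma measurable_step_below d (T : measurableType d) (f : T -> \bar R) n h :
  measurable_fun setT f ->
  measurable_fun setT (fun x => (step_below n h (f x))%:E).
Proof.
move=> mf; under eq_fun do rewrite step_below_indic.
apply: emeasurable_sum => i; apply: measurable_funeM.
apply/measurable_EFinP; apply: measurable_indic.
by rewrite -[X in measurable X]setTI; exact: emeasurable_fun_o_infty.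
Qed.

Lemma integral_step_below d (T : measurableType d) (mu : probability T R)
    (f : T -> \bar R) n h : (0 <= h)%R -> measurable_fun setT f ->
  \int[mu]_x (step_below n h (f x))%:E =
  (\sum_(0 <= i < n) h * fine (mu [set x | ((i.+1%:R * h)%:E < f x)%E]))%:E.
Proof.
move=> h0 mf.
have mS a : measurable [set x | a%:E < f x].
  by rewrite -[X in measurable X]setTI; exact: emeasurable_fun_o_infty.
under eq_integral do rewrite step_below_indic.
rewrite ge0_integral_sum//=; last 2 first.
- move=> i; apply: measurable_funeM.
  by apply/measurable_EFinP; apply: measurable_indic; exact: mS.
- by move=> i x _; rewrite mule_ge0// lee_fin.
rewrite -sumEFin; apply: eq_bigr => i _.
rewrite ge0_integralZl_EFin//; last first.
  by apply/measurable_EFinP; apply: measurable_indic; exact: mS.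
rewrite integral_indic//.
by rewrite setIT (EFinM h) fineK// fin_num_measure.
Qed.

End step_below.

Section lsc_integral.
Context (R : realType) (T : ptopologicalType).

Lemma lsc_borel_measurable (f : T -> \bar R) : lower_semicontinuous f ->
  measurable_fun [set: borel T] (f : borel T -> \bar R).
Proof.
move=> /lower_semicontinuousP of_.
apply: (measurability _ (ErealGenOInfty.measurableE R)).
move=> /= _ [_ [a ->]] <-; rewrite setTI preimage_itvoy.
by apply: sub_sigma_algebra; exact: of_.
Qed.

(** Each step sum [g m] lies below f and integrates to a finite combination of measures of open
    sets, so its Q-integral is at most M. The meshes are not nested and [g] is not monotone in m, so
    Fatou's lemma concludes. *)
Lemma lsc_integral_ultra (P : nat -> borel_prob R T) (Q : borel_prob R T)
    (U : set_system nat) (f : T -> \bar R) (M : \bar R) :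
  UltraFilter U ->
  (forall G : set T, open G -> Q G <= (ultra_content R T P U G)%:E) ->
  lower_semicontinuous f -> (forall x, 0 <= f x) ->
  (fun n => \int[P n]_x f x) @ U --> M ->
  \int[Q]_x f x <= M.
Proof.
move=> UU QU lf f0 fM.
have UF : ProperFilter U by exact: ultra_proper.
have mf := lsc_borel_measurable f lf.
have h0 m : (0 <= m.+1%:R^-1 :> R)%R by rewrite invr_ge0.
pose g m (x : borel T) := (step_below R (m.+1 ^ 2) m.+1%:R^-1 (f x))%:E.
have mg m : measurable_fun setT (g m) by exact: measurable_step_below.
have g0 m x : 0 <= g m x by rewrite lee_fin step_below_ge0.
have gM m : \int[Q]_x g m x <= M.
  rewrite integral_step_below//.
  pose G i := [set x | (i.+1%:R * m.+1%:R^-1)%:E < f x] : set T.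
  have oG i : open (G i) by move/lower_semicontinuousP : lf; exact.
  have mG i : measurable (G i : set (borel T)) by exact: sub_sigma_algebra.
  apply: (@le_trans _ _ (\sum_(0 <= i < m.+1 ^ 2)
      m.+1%:R^-1 * ultra_content R T P U (G i))%:E).
    rewrite lee_fin; apply: ler_sum => i _; apply: ler_wpM2l => //.
    rewrite -lee_fin fineK; first exact: QU (oG i).
    by apply: fin_num_measure; exact: mG.
  have cvgS : (fun n => (\sum_(0 <= i < m.+1 ^ 2)
      m.+1%:R^-1 * fine (P n (G i)))%:E) @ U -->
      (\sum_(0 <= i < m.+1 ^ 2)
      m.+1%:R^-1 * ultra_content R T P U (G i))%:E.
    apply: cvg_EFin; first exact: nearW.
    apply: cvg_big => [|i _]; first exact: add_continuous.
    by apply: cvgMr; exact: ultra_content_cvg.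
  rewrite -(cvg_lim _ cvgS)// -(cvg_lim _ fM)//.
  apply: lee_lim; [exact: cvgP cvgS|exact: cvgP fM|].
  apply: nearW => n; rewrite -integral_step_below//.
  apply: ge0_le_integral => //; first by move=> x _; exact: g0.
    exact: (mg m).
  by move=> x _; exact: step_below_leE.
have -> : \int[Q]_x f x = \int[Q]_x limn_einf (g ^~ x).
  apply: eq_integral => x _.
  by have [-> _] := cvg_limn_einf_sup (step_below_cvg R (f x) (f0 x)).
apply: (le_trans (fatou _ _ _ _)) => //.
(* The lower limit is the limit of the infima over tails, and the infimum over the tail from n is at
   most the n-th integral. *)
rewrite limn_einf_lim; apply: lime_le; first exact: is_cvg_einfs.
apply: nearW => n; apply: le_trans (gM n); apply: ereal_inf_lbound.
by exists n => //=.
Qed.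

End lsc_integral.

(** * Separation properties of the path space *)

Section metric.
Context (R : realType) (T : topologicalType) (d : T -> T -> R).
Hypothesis hd : complete_metric_for d.

Lemma complete_metric_hausdorff : hausdorff_space T.
Proof.
have [[d0 dE dC dT] [nb _]] := hd.
move=> p q pq; apply: contrapT => npq.
have e0 : (0 < d p q / 2)%R.
  rewrite divr_gt0// lt_neqAle d0 andbT eq_sym; apply/eqP => /dE; exact: npq.
have [|//|z [/= pz qz]] := pq [set y | (d p y < d p q / 2)%R]
    [set y | (d q y < d p q / 2)%R].
- by apply/nb; exists (d p q / 2)%R.
- by apply/nb; exists (d p q / 2)%R.
- by have := dT p z q; rewrite (dC z q); lra.
Qed.

End metric.

(** The closed sets are taken increasing so that continuity of measures from below applies
    directly. *)
Definition open_Fsigma (T : topologicalType) : Prop := forall U : set T, open U ->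
  exists F : nat -> set T, [/\ forall n, closed (F n),
    nondecreasing_seq F & U = \bigcup_n F n].

Lemma complete_metric_Fsigma (R : realType) (T : topologicalType)
  (d : T -> T -> R) : complete_metric_for d -> open_Fsigma T.
Proof.
move=> [[d0 dE dC dT] [nb _]] U oU.
(* Points at distance at least 1/(n+1) from the complement of U. Quantifying over y avoids an
   infimum and covers an empty complement. *)
exists (fun n => [set x | forall y, ~ U y -> (n.+1%:R^-1 <= d x y)%R]); split.
- move=> n; rewrite -[X in closed X]setCK; apply: open_closedC.
  rewrite openE => x /= /existsNP[y /not_implyP[Uy /negP]].
  rewrite -ltNge => xy; apply/nb; exists (n.+1%:R^-1 - d x y)%R.
    by rewrite subr_gt0.
  move=> z /= xz /(_ y Uy); apply/negP; rewrite -ltNge.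
  have := dT z x y; rewrite (dC z x) => zy; apply: (le_lt_trans zy).
  by rewrite -ltrBrDr.
- move=> m n mn; apply/subsetPset => x /= H y /H; apply: le_trans.
  by rewrite lef_pV2 ?posrE ?ltr0n// ler_nat.
- apply/seteqP; split => x.
    move=> Ux; have /nb[e e0 eU] := open_nbhs_nbhs (conj oU Ux).
    have [n ne] : exists n, (n.+1%:R^-1 < e)%R.
      have [n _ /(_ n (leqnn n))] := near_infty_natSinv_lt (PosNum e0).
      by exists n.
    exists n => //= y Uy; rewrite leNgt; apply/negP => xy.
    by apply/Uy/eU => /=; exact: lt_trans ne.
  move=> [n _ /= H]; apply: contrapT => /H; apply/negP; rewrite -ltNge.
  by rewrite (dE x x).2// invr_gt0 ltr0n.
Qed.

Lemma open_adjoin_image (T : topologicalType) (A : set T) : open A ->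
  open ((Some : T -> adjoin_pt T) @` A).
Proof.
move=> oA; rewrite open_adjoin_ptE (_ : _ @^-1` _ = A)//.
by apply/seteqP; split => [x [y Ay [<-]]//|x Ax]; exists x.
Qed.

Lemma adjoin_hausdorff (T : topologicalType) :
  hausdorff_space T -> hausdorff_space (adjoin_pt T).
Proof.
have oS : open ((Some : T -> adjoin_pt T) @` setT).
  by apply: open_adjoin_image; exact: openT.
have oN := @open_adjoin_pt_None T.
rewrite !open_hausdorff => hT [x|] [y|] xy //.
- have /hT[[A B] /= [xA yB] [oA oB AB0]] : x != y.
    by apply: contra_neq xy => ->.
  exists ((Some : T -> adjoin_pt T) @` A, (Some : T -> adjoin_pt T) @` B) => /=.
    by rewrite !inE in xA yB *; split; [exists x|exists y].
  split; [exact: open_adjoin_image|exact: open_adjoin_image|].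
  apply/eqP/seteqP; split => // z [[a Aa <-] [b Bb [ba]]].
  suff : (A `&` B) a by rewrite (eqP AB0).
  by split => //; rewrite -ba.
- exists ((Some : T -> adjoin_pt T) @` setT, [set None]) => /=.
    by rewrite !inE; split => //; exists x.
  by split => //; apply/eqP/seteqP; split => // z [[a _ <-]].
- exists ([set None], (Some : T -> adjoin_pt T) @` setT) => /=.
    by rewrite !inE; split => //; exists y.
  by split => //; apply/eqP/seteqP; split => // z [-> []].
Qed.

Lemma adjoin_Fsigma (T : topologicalType) :
  open_Fsigma T -> open_Fsigma (adjoin_pt T).
Proof.
move=> hT U; rewrite open_adjoin_ptE => /hT[F [cF ndF UF]].
(* The isolated point is both open and closed, so when U contains it, it can be put into every
   closed set. *)
exists (fun n => (Some @` F n) `|` (U `&` [set None])); split.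
- move=> n; rewrite -openC open_adjoin_ptE.
  rewrite (_ : _ @^-1` _ = ~` F n); first exact: closed_openC.
  rewrite preimage_setC; congr (~` _); apply/seteqP; split => x.
    by move=> [[y Fy [<-]]|[_]].
  by move=> Fx; left; exists x.
- move=> m n /ndF/subsetPset mn; apply/subsetPset => x [[y Fy <-]|Ux]; last by right.
  by left; exists y => //; exact: mn.
- apply/seteqP; split => -[x|].
  + move=> Ux; have : (Some @^-1` U) x by [].
    by rewrite UF => -[n _ Fx]; exists n => //; left; exists x.
  + by move=> UN; exists 0%N => //; right.
  + move=> [n _ [[y Fy [<-]]|[]//]].
    have : (\bigcup_n F n) y by exists n.
    by rewrite -UF.
  + by move=> [n _ [[y]//|[]]].
Qed.

Lemma hat_hausdorff (R : realType) (b : bool) (T : spaceType b) :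
  polish R T -> hausdorff_space (hat T).
Proof.
by case: b T => /= T [_ [d hd]]; [apply: adjoin_hausdorff|];
  exact: complete_metric_hausdorff hd.
Qed.

Lemma hat_Fsigma (R : realType) (b : bool) (T : spaceType b) :
  polish R T -> open_Fsigma (hat T).
Proof.
by case: b T => /= T [_ [d hd]]; [apply: adjoin_Fsigma|];
  exact: complete_metric_Fsigma hd.
Qed.

(** Complements turn the bound on open sets into the reverse bound on closed sets, which passes to
    open sets along increasing closed unions. Open sets are stable under intersection and generate,
    so equality on them suffices. *)
Lemma borel_prob_eq (R : realType) (T : ptopologicalType)
    (Q mu : borel_prob R T) : open_Fsigma T ->
  (forall U : set T, open U -> Q U <= mu U) ->
  forall A : set (borel T), measurable A -> Q A = mu A.
Proof.
move=> FT Qmu.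
have muQ (F : set T) : closed F -> mu F <= Q F.
  move=> cF; have mF := closed_borel _ _ cF.
  have := Qmu _ (closed_openC cF).
  have -> : Q (~` F) = 1 - Q F by exact: probability_setC.
  have -> : mu (~` F) = 1 - mu F by exact: probability_setC.
  by rewrite leeD2lE// leeN2.
have QmuE (U : set (borel T)) : @open T U -> Q U = mu U.
  move=> oU; apply/eqP; rewrite eq_le Qmu//=.
  have [F [cF ndF UF]] := FT U oU.
  have mF n : measurable (F n : set (borel T)) := closed_borel _ _ (cF n).
  have mUF : measurable (\bigcup_n F n : set (borel T)).
    exact: bigcupT_measurable.
  have cv := @nondecreasing_cvg_mu _ (borel T) R mu F mF mUF ndF.
  rewrite UF; apply: (cvge_to_le cv); apply: nearW => n /=.
  apply: (le_trans (muQ _ (cF n))); apply: le_measure; rewrite ?inE//.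
  exact: bigcup_sup.
have gT : \bigcup_(k : nat) setT = [set: borel T].
  by apply/seteqP; split => // x _; exists 0%N.
have Qfin (k : nat) : Q setT < +oo by rewrite probability_setT ltry.
exact: (@measure_unique _ R (borel T) (@open T) (fun=> setT) erefl (@openI T)
  (fun=> openT) gT Q mu QmuE Qfin).
Qed.

Lemma continuous_borel_measurable (S T : ptopologicalType) (f : S -> T) :
  continuous f -> measurable_fun [set: borel S] (f : borel S -> borel T).
Proof.
move=> cf; apply: (@measurability _ _ (borel S) (borel T) setT f (@open T) (erefl _)).
move=> _ [A oA <-].
by rewrite setTI; apply: sub_sigma_algebra; apply: open_comp => // x _; exact: cf.
Qed.

Lemma proj_path_continuous (K : nat) (X : forall k : 'I_K.+1, spaceType (inner k))
  (k : 'I_K.+1) : continuous (@proj_path K X k).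
Proof. exact: proj_continuous. Qed.

Lemma path_space_hausdorff (K : nat) (X : forall k : 'I_K.+1, spaceType (inner k)) :
  (forall k, hausdorff_space (hat (X k))) -> hausdorff_space (path_space X).
Proof. exact: hausdorff_product. Qed.

(** * Lower semicontinuity of the path cost *)

(** Pointwise lower semicontinuity of a sum: a real a below the sum splits as a <= b + c with b and
    c strictly below the two terms. *)
Lemma near_lteD (R : realType) (T : topologicalType) (f g : T -> \bar R) (x : T) :
  (forall y, 0 <= f y) -> (forall y, 0 <= g y) ->
  (forall a : R, a%:E < f x -> \forall y \near x, a%:E < f y) ->
  (forall a : R, a%:E < g x -> \forall y \near x, a%:E < g y) ->
  forall a : R, a%:E < f x + g x -> \forall y \near x, a%:E < f y + g y.
Proof.
move=> f0 g0 lf lg a afg.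
suff [b [c [bf cg abc]]] : exists b c : R,
    [/\ b%:E < f x, c%:E < g x & (a <= b + c)%R].
  near=> y; apply: (@le_lt_trans _ _ (b%:E + c%:E)); first by rewrite -EFinD lee_fin.
  by apply: lteD; near: y; [exact: lf|exact: lg].
(* Two finite values share the slack equally. If only one is infinite, it takes a + 1 and the other
   -1, which is below it by nonnegativity. *)
have := f0 x; have := g0 x; move: afg; case: (f x) => [r| |//]; case: (g x) => [s| |//].
- rewrite -EFinD lte_fin => ars _ _.
  exists (r - (r + s - a) / 2)%R, (s - (r + s - a) / 2)%R.
  by split; rewrite ?lte_fin; lra.
- move=> _ _; rewrite lee_fin => r0; exists (-1)%R, (a + 1)%R.
  by split; rewrite ?ltry ?lte_fin//; lra.
- move=> _; rewrite lee_fin => s0 _; exists (a + 1)%R, (-1)%R.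
  by split; rewrite ?ltry ?lte_fin//; lra.
- by move=> _ _ _; exists a, 0%R; split; rewrite ?ltry//; lra.
Unshelve. all: by end_near. Qed.

(** The copy of T inside its augmentation is open, so being visited persists nearby and the visited
    point moves continuously. *)
Lemma near_visited_Some (b : bool) (T : spaceType b) (p : hat T) (x : T) (A : set T) :
  visited p = Some x -> nbhs x A ->
  \forall q \near p, exists2 x', visited q = Some x' & A x'.
Proof.
case: b T p x A => /= T p x A.
  move=> -> ; rewrite nbhsE => -[B [oB Bx] BA].
  have : nbhs (Some x : adjoin_pt T) ((Some : T -> adjoin_pt T) @` B).
    by apply: open_nbhs_nbhs; split; [exact: open_adjoin_image|exists x].
  by apply: filterS => q [x' Bx' <-]; exists x' => //; exact: BA.
by move=> [<-]; apply: filterS => q Aq; exists q.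
Qed.

Lemma near_visited_None (b : bool) (T : spaceType b) (p : hat T) :
  visited p = None -> \forall q \near p, visited q = None.
Proof.
case: b T p => //= T p ->.
by apply: open_nbhs_nbhs; split => //; exact: open_adjoin_pt_None.
Qed.

Section path_cost_lsc.
Context (R : realType) (K : nat) (X : forall k : 'I_K.+1, spaceType (inner k)).
Context (c : forall i j : 'I_K.+1, X i * X j -> \bar R).
Hypothesis c_ge0 : forall i j : 'I_K.+1, (i < j)%N -> forall xy, 0 <= c i j xy.
Hypothesis c_lsc : forall i j : 'I_K.+1, (i < j)%N -> lower_semicontinuous (c i j).

Lemma step_cost_ge0 (w : path_space X) (i j : 'I_K.+1) :
  (i < j)%N -> 0 <= step_cost c w i j.
Proof.
move=> ij; rewrite /step_cost.
by case: (visited _) => // x; case: (visited _) => // y; exact: c_ge0.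
Qed.

Lemma near_step_cost (w : path_space X) (i j : 'I_K.+1) (a : R) : (i < j)%N ->
  a%:E < step_cost c w i j -> \forall v \near w, a%:E < step_cost c v i j.
Proof.
(* This settles the cases where i or j is inactive at w: the step cost is then the default 0, so a
   is negative. *)
move=> ij; have a0 : a%:E < 0 -> \forall v \near w, a%:E < step_cost c v i j.
  move=> a0; apply: (@nearW _ (nbhs w)) => v.
  by apply: (lt_le_trans a0); exact: step_cost_ge0.
rewrite {1}/step_cost.
case wi : (visited (proj_path i w)) => [x|]; last exact: a0.
case wj : (visited (proj_path j w)) => [y|]; last exact: a0.
move=> /(c_lsc i j ij)[V [[A B] /= [Ax By] ABV] aV].
have nA := @proj_path_continuous K X i w _ (near_visited_Some _ _ _ _ _ wi Ax).
have nB := @proj_path_continuous K X j w _ (near_visited_Some _ _ _ _ _ wj By).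
apply: (filterS2 (F := nbhs w)) nA nB => v /= [x' vi Ax'] [y' vj By'].
by rewrite /step_cost vi vj; apply: aV; exact: ABV.
Qed.

(** Activity of each index is locally constant, and there are finitely many indices. *)
Lemma near_active (w : path_space X) : \forall v \near w, active v = active w.
Proof.
have H : \forall v \near w, forall k : 'I_K.+1,
    isSome (visited (proj_path k v)) = isSome (visited (proj_path k w)).
  apply: (@filter_forall _ _ _ (nbhs w)) => k.
  case wk : (visited (proj_path k w)) => [x|].
    have nT : nbhs x setT by exact: filterT.
    have H := @proj_path_continuous K X k w _ (near_visited_Some _ _ _ _ _ wk nT).
    by apply: (@filterS _ (nbhs w) _ _ _ _ H) => v /= [x' -> _].
  have H := @proj_path_continuous K X k w _ (near_visited_None _ _ _ wk).
  by apply: (@filterS _ (nbhs w) _ _ _ _ H) => v /= ->.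
by apply: (filterS (F := nbhs w)) H => v vw; apply: eq_filter.
Qed.

(** Filtering preserves the increasing order of the enumeration. This gives access to the hypotheses
    on [c i j], stated only for i < j. *)
Lemma active_ltn (w : path_space X) (l : nat) : (l < (size (active w)).-1)%N ->
  (nth ord0 (active w) l < nth ord0 (active w) l.+1)%N.
Proof.
move=> lw; have lw' : (l.+1 < size (active w))%N by rewrite -ltn_predRL.
have sw : sorted (fun i j : 'I_K.+1 => i < j)%N (active w).
  apply: sorted_filter; first by move=> y x z; exact: ltn_trans.
  by have := iota_ltn_sorted 0 K.+1; rewrite -val_enum_ord sorted_map.
apply: (sorted_ltn_nth _ _ sw) => //.
- by move=> y x z; exact: ltn_trans.
- by rewrite inE (ltn_trans _ lw').
Qed.

Lemma path_cost_ge0 (w : path_space X) : 0 <= path_cost c w.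
Proof.
rewrite /path_cost big_nat; apply: sume_ge0 => l lw.
by apply: step_cost_ge0; exact: active_ltn.
Qed.

Lemma path_cost_lsc : lower_semicontinuous (path_cost c).
Proof.
move=> w a; set s := active w.
(* Partial costs along the active list of w, kept fixed while v varies. For v near w, [near_active]
   identifies the full sum with the path cost. *)
pose S n v := \sum_(0 <= l < n) step_cost c v (nth ord0 s l) (nth ord0 s l.+1).
have S0 n v : (n <= (size s).-1)%N -> 0 <= S n v.
  move=> ns; rewrite /S big_nat; apply: sume_ge0 => l /andP[_ ln].
  by apply/step_cost_ge0/active_ltn/(leq_trans ln).
have lS n : (n <= (size s).-1)%N -> forall b : R, b%:E < S n w ->
    \forall v \near w, b%:E < S n v.
  elim: n => [_ b|n IH ns].
    by rewrite /S big_geq// => b0; apply: (@nearW _ (nbhs w)) => v; rewrite big_geq.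
  have -> : S n.+1 = fun v => S n v + step_cost c v (nth ord0 s n) (nth ord0 s n.+1).
    by apply/funext => v; rewrite /S big_nat_recr.
  have nn := active_ltn w n ns.
  apply: near_lteD => [v|v|b'|b'].
  - by apply: S0; exact: ltnW.
  - exact: step_cost_ge0.
  - by apply: IH; exact: ltnW.
  - exact: near_step_cost.
move=> aw; exists [set v | a%:E < path_cost c v] => //.
have := lS _ (leqnn _) a aw.
by apply: (filterS2 (F := nbhs w)) (near_active w) => v vw; rewrite /path_cost /S /= vw.
Qed.

End path_cost_lsc.

(** * Existence of a minimizer *)

Lemma markov_tight (R : realType) (T : ptopologicalType) (P : nat -> borel_prob R T)
    (Phi : borel T -> \bar R) :
  measurable_fun setT Phi -> (forall w, 0 <= Phi w) ->
  (forall r : R, (0 < r)%R -> compact ([set w | Phi w <= r%:E] : set T)) ->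
  ereal_sup (range (fun n => \int[P n]_w Phi w)) < +oo ->
  forall e : R, (0 < e)%R ->
    exists2 H : set T, compact H & forall n, (1 - e)%:E <= P n H.
Proof.
move=> mPhi Phi0 cPhi supPhi e e0.
set s := ereal_sup _ in supPhi.
have intPhi n : \int[P n]_w Phi w <= s by apply: ereal_sup_ubound; exists n.
have s0 : 0 <= s.
  by apply: le_trans (intPhi 0%N); apply: integral_ge0 => w _; exact: Phi0.
have sfin : s \is a fin_num by rewrite ge0_fin_numE.
have C0 : (0 < fine s + 1)%R by have := fine_ge0 s0; lra.
(* Markov's inequality at this level bounds the mass outside by se/(s+1) <= e; adding 1 keeps the
   level positive when s = 0. *)
have r0 : (0 < (fine s + 1) / e)%R by rewrite divr_gt0.
exists [set w | Phi w <= ((fine s + 1) / e)%:E]; first exact: cPhi.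
move=> n; set H := (X in P n X).
have mH : measurable (H : set (borel T)).
  by rewrite -[X in measurable X]setTI; exact: emeasurable_fun_infty_c.
have mHC := measurableC mH.
have PHC : P n (~` H) <= e%:E.
  have := @le_integral_comp_abse _ _ _ (P n) setT measurableT Phi
    ((fine s + 1) / e)%R id (@measurable_id _ _ _) (fun _ => id)
    (fun _ _ _ _ => id) mPhi r0.
  rewrite setTI; under eq_integral do rewrite gee0_abs//.
  move=> /le_trans/(_ (intPhi n)) le_s.
  have HCle : P n (~` H) <= P n [set x | ((fine s + 1) / e)%:E <= `|Phi x|].
    apply: le_measure; rewrite ?inE//.
      by rewrite -[X in measurable X]setTI; apply: emeasurable_fun_c_infty => //;
        exact: measurableT_comp.
    by move=> w /= /negP; rewrite -ltNge gee0_abs// => /ltW.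
  have : ((fine s + 1) / e)%:E * P n (~` H) <= (fine s + 1)%:E.
    apply: (@le_trans _ _ s).
      by apply: le_trans le_s; apply: lee_wpmul2l => //; rewrite lee_fin ltW.
    by rewrite -{1}(fineK sfin) lee_fin; lra.
  rewrite -(@fineK _ (P n (~` H))) ?fin_num_measure// -EFinM !lee_fin.
  by rewrite mulrAC ler_pdivrMr// ler_pM2l.
have -> : P n H = 1 - P n (~` H).
  by rewrite -probability_setC// setCK.
by rewrite EFinB leeB.
Qed.

Definition marginal (R : realType) (K : nat)
    (X : forall k : 'I_K.+1, spaceType (inner k))
    (Q : borel_prob R (path_space X)) (k : 'I_K.+1) : borel_prob R (hat (X k)) :=
  distribution Q (mfun_Sub (mem_set
    (continuous_borel_measurable _ _ _ (@proj_path_continuous K X k)))).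

Lemma has_marginal_marginal (R : realType) (K : nat)
    (X : forall k : 'I_K.+1, spaceType (inner k))
    (Q : borel_prob R (path_space X)) (k : 'I_K.+1) :
  has_marginal Q (marginal R K X Q k).
Proof. by []. Qed.

(** For open V, every [P n] gives the open preimage of V mass [mu V], so the marginal of Q is at
    most [mu] on open sets and [borel_prob_eq] applies. *)
Lemma has_marginal_ultra (R : realType) (K : nat)
    (X : forall k : 'I_K.+1, spaceType (inner k))
    (P : nat -> borel_prob R (path_space X)) (Q : borel_prob R (path_space X))
    (U : set_system nat) (k : 'I_K.+1) (mu : borel_prob R (hat (X k))) :
  UltraFilter U -> open_Fsigma (hat (X k)) ->
  (forall G : set (path_space X), open G ->
    Q G <= (ultra_content R (path_space X) P U G)%:E) ->
  (forall n, has_marginal (P n) mu) -> has_marginal Q mu.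
Proof.
move=> UU FX QU Pmu A mA; rewrite has_marginal_marginal//.
apply: borel_prob_eq A mA => // V oV.
have oW : open (@proj_path K X k @^-1` V).
  by apply: open_comp oV => w _; exact: proj_path_continuous.
apply: (le_trans (QU _ oW)).
have mV := open_borel _ _ oV.
rewrite -(@fineK _ (mu V)) ?fin_num_measure// lee_fin.
apply: ultra_content_le; first exact: open_borel.
move=> n; rewrite fineK ?fin_num_measure//.
by rewrite -(Pmu n).
Qed.

Theorem theorem2p2 (R : realType) (K : nat) (hK : (1 <= K)%N)
    (X : forall k : 'I_K.+1, spaceType (inner k))
    (hX : forall k : 'I_K.+1, polish R (X k))
    (c : forall i j : 'I_K.+1, X i * X j -> \bar R)
    (c_ge0 : forall i j : 'I_K.+1, (i < j)%N -> forall xy, 0 <= c i j xy)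
    (c_lsc : forall i j : 'I_K.+1, (i < j)%N -> lower_semicontinuous (c i j))
    (mu0 : borel_prob R (hat (X ord0)))
    (muK : borel_prob R (hat (X ord_max)))
    (hM : optimal_value c mu0 muK < +oo)
    (hc : coercive c mu0 muK) :
  exists mu : forall k : 'I_K.+1, borel_prob R (hat (X k)),
    [/\ mu ord0 = mu0, mu ord_max = muK &
        exists2 pi : borel_prob R (path_space X),
          couplings mu pi & total_cost c pi = optimal_value c mu0 muK].
Proof.
have [Phi [mPhi Phi0 cPhi [P [P0 PK PM] supPhi]]] := hc.
have [U [UU ooU]] := @ultraFilterLemma nat \oo eventually_filter.
have hT := path_space_hausdorff K X (fun k => hat_hausdorff _ _ _ (hX k)).
have tP := markov_tight _ _ P Phi mPhi Phi0 cPhi supPhi.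
have [Q QU] := prokhorov_ultra R (path_space X) P U UU hT tP.
have Q0 : has_marginal Q mu0.
  by apply: has_marginal_ultra QU P0 => //; exact: hat_Fsigma (hX ord0).
have QK : has_marginal Q muK.
  by apply: has_marginal_ultra QU PK => //; exact: hat_Fsigma (hX ord_max).
(* The marginals of Q agree with [mu0] and [muK] on measurable sets, but the goal asks for equal
   probabilities, so both ends are overwritten. The indices 0 and K differ because 1 <= K. *)
pose mu := dfwith (dfwith (marginal R K X Q) ord_max muK) ord0 mu0.
have muE0 : mu ord0 = mu0 by rewrite /mu dfwithin.
have muEK : mu ord_max = muK.
  by rewrite /mu dfwithout ?dfwithin// -val_eqE/= eq_sym -lt0n.
have Qmu : couplings mu Q.
  move=> k; rewrite /mu; case: dfwithP => // k0 _.
  by case: dfwithP => // k1 _; exact: has_marginal_marginal.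
exists mu; split => //; exists Q => //.
(* Q is admissible, so its cost is at least the infimum; the converse follows from lower
   semicontinuity, convergence of the costs at infinity being inherited by U. *)
apply/eqP; rewrite eq_le; apply/andP; split; last first.
  by apply: ereal_inf_lbound; exists mu; split => //; exists Q.
apply: (lsc_integral_ultra _ _ P Q U) => //.
- exact: path_cost_lsc.
- by move=> w; exact: path_cost_ge0.
- by move=> A /PM /ooU.
Qed.
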